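(* Let $\xi\colon\mathcal{E}\to M$ be an infinitely prolonged differential equation, $\pi\colon E\to M$ a fiber bundle of finite rank, and let $\tau=\xi^*(\pi)\colon\mathcal{E}'\to\mathcal{E}$ be its pullback endowed with a covering structure given by a flat connection $\mathcal{F}\colon \mathrm{D}(M)\to \mathrm{D}(\mathcal{E}')$ with $\tau_*\circ\mathcal{F}=\mathcal{C}$. Let $S$ be a symmetry of $\mathcal{E}$, and let $\hat S$ be its canonical lift to a symmetry of the equation $(\mathcal{E}',\mathcal{C}_1)$. Consider the complex $(\mathcal{V}_{\mathcal{E}}^\bullet,[\![\bar U_{\mathcal{F}},\cdot\,]\!])$ corresponding to the flat representation $\mathcal{F}$ of $(\mathcal{E}',\mathcal{C}_1)$. Then the cocycle $c_{\hat S}=[\![\bar U_{\mathcal{F}},\hat S]\!]$ is exact (i.e. $c_{\hat S}=[\![\bar U_{\mathcal{F}},V]\!]$ for some $V\in\mathcal{V}_{\mathcal{E}}$) if and only if there is a symmetry $S'\in \mathrm{D}(\mathcal{E}')$ of the covering equation $(\mathcal{E}',\mathcal{F})$ such that $\tau_*(S')=S$.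
   Context: $\mathrm{D}(P)$ denotes vector fields on a manifold $P$. $\xi\colon\mathcal{E}\to M$ is the infinite prolongation of a formally integrable PDE with space of independent variables $M$, with flat Cartan connection $\mathcal{C}\colon \mathrm{D}(M)\to \mathrm{D}(\mathcal{E})$; the module $\mathcal{C}\mathrm{D}_{\mathcal{E}}$ generated by the fields $\mathcal{C}X$ is the Cartan distribution. For a pair (bundle over a base $B$, flat connection $\nabla$ in it), regarded as an equation with $\nabla$ as its Cartan connection, a symmetry is a vector field vertical over $B$ commuting with $\nabla X$ for all $X\in \mathrm{D}(B)$. In particular symmetries of $\mathcal{E}$ are $\xi$-vertical fields commuting with all $\mathcal{C}X$, and symmetries of the covering equation $(\mathcal{E}',\mathcal{F})$ are fields on $\mathcal{E}'$ that are vertical over $M$ and commute with all $\mathcal{F}X$, $X\in \mathrm{D}(M)$. The pullback diagram has projections $\tau\colon\mathcal{E}'=\mathcal{E}\times_M E\to\mathcal{E}$ and $\xi'\colon\mathcal{E}'\to E$, with $\xi\circ\tau=\pi\circ\xi'$. The condition $\tau_*\circ\mathcal{F}=\mathcal{C}$ means $\tau_*(\mathcal{F}X)_{\theta'}=(\mathcal{C}X)_{\tau(\theta')}$ for all $X\in \mathrm{D}(M)$ and $\theta'\in\mathcal{E}'$; $\mathcal{F}$ is a flat connection in the bundle $\pi\circ\xi'\colon\mathcal{E}'\to M$. Let $\mathcal{C}\mathrm{D}_1=\tau_*^{-1}(\mathcal{C}\mathrm{D}_{\mathcal{E}})\subset \mathrm{D}(\mathcal{E}')$ be the distribution of fields whose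 $\tau$-projection at each point lies in the Cartan distribution of $\mathcal{E}$. It is mapped isomorphically by $\xi'_*$ onto tangent spaces of $E$ and so defines a flat connection $\mathcal{C}_1\colon \mathrm{D}(E)\to \mathrm{D}(\mathcal{E}')$ in $\xi'\colon\mathcal{E}'\to E$. $(\mathcal{E}',\mathcal{C}_1)$ is an equation with $E$ as space of independent variables. (Locally it is obtained from $\mathcal{E}$ by letting the dependent variables $u^j$ depend also on the fiber coordinates $w_k$ of $\pi$ and adding the equations $\partial u^j/\partial w_k=0$.) Since $\mathcal{F}(X)\in\mathcal{C}\mathrm{D}_1$ for $X\in\mathrm{D}(M)$, the bundle $\pi\colon E\to M$ and $\mathcal{F}$ form a flat representation of $(\mathcal{E}',\mathcal{C}_1)$. In general, a flat representation of an equation with space of independent variables $E$, in a bundle $E\to M$, is a flat connection in the composed bundle over $M$ taking values in the Cartan distribution. Complex. $\mathcal{V}_{\mathcal{E}}$ is the module of fields in $\mathcal{C}\mathrm{D}_1$ that are vertical over $M$, i.e. the $\tau$-vertical vector fields on $\mathcal{E}'$. $\mathcal{V}_{\mathcal{E}}^q$ is the module of $\mathcal{V}_{\mathcal{E}}$-valued $q$-forms pulled back from $M$ (that is, $(\pi\circ\xi')^*(\Lambda^q(M))\otimes\mathcal{V}_{\mathcal{E}}$). In local coordinates $x_i$ on $M$, $\bar U_{\mathcal{F}}=\sum_i dx_i\otimes\mathcal{F}(\partial_{x_i})$. $[\![\cdot,\cdot]\!]$ is the Frölicher–Nijenhuis bracket; for a vector field $Y$ vertical over $M$, $[\![\bar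 U_{\mathcal{F}},Y]\!]=\sum_i dx_i\otimes[\mathcal{F}(\partial_{x_i}),Y]$. Canonical lift. Since $\mathcal{E}'=\mathcal{E}\times_M E$, every $\xi$-vertical vector field $Y$ on $\mathcal{E}$ has a unique lift $\hat Y$ to $\mathcal{E}'$ that is $\xi'$-vertical and satisfies $\tau_*\hat Y=Y$. If $S$ is a symmetry of $\mathcal{E}$, then $\hat S$ is a symmetry of $(\mathcal{E}',\mathcal{C}_1)$, and $c_{\hat S}\in\mathcal{V}^1_{\mathcal{E}}$ is a $1$-cocycle. *)

(* Defs.v *)
From HB Require Import structures.
From mathcomp Require Import all_boot all_order all_algebra.
From mathcomp Require Import all_classical all_reals topology normedtype derive.
From mathcomp Require Import ring.

Set Implicit Arguments.
Unset Strict Implicit.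
Unset Printing Implicit Defensive.

Import Order.TTheory GRing.Theory Num.Theory.
Import numFieldNormedType.Exports.

Local Open Scope classical_set_scope.
Local Open Scope ring_scope.

(** Smooth functions on [R^n]. *)
Section Euclidean.
Variable R : realType.

Fixpoint Ck n (k : nat) (f : 'rV[R]_n -> R) : Prop :=
  if k is k'.+1 then
    continuous f /\
    forall i : 'I_n, (forall x, derivable f x (delta_mx 0 i)) /\
                     Ck k' (fun x => 'D_(delta_mx 0 i) f x)
  else continuous f.

Definition Cinfty n (f : 'rV[R]_n -> R) : Prop := forall k, Ck k f.

Lemma Ck_continuous n k (f : 'rV[R]_n -> R) : Ck k f -> continuous f.
Proof. by case: k => [|k] // []. Qed.

Lemma CkW n k (f : 'rV[R]_n -> R) : Ck k.+1 f -> Ck k f.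
Proof.
elim: k f => [|k IH] f; first by move=> /= [].
move=> [cf H]; by split=> // i; have [df Hf] := H i; split=> //; exact: IH.
Qed.

Lemma Ck_cst n k (c : R) : Ck k (cst c : 'rV[R]_n -> R).
Proof.
elim: k c => [|k IH] c /=; first exact: cst_continuous.
split=> [|i]; first exact: cst_continuous.
split=> [x|]; first exact: derivable_cst.
have -> : (fun x => 'D_(delta_mx 0 i) (cst c) x) = cst 0 :> ('rV[R]_n -> R)
  by apply/funext => x; rewrite derive_cst.
exact: IH.
Qed.

Lemma CkB n k (f g : 'rV[R]_n -> R) : Ck k f -> Ck k g -> Ck k (f - g).
Proof.
elim: k f g => [|k IH] f g /=.
  by move=> cf cg x; apply: continuousB; [exact: cf|exact: cg].
move=> [cf Hf] [cg Hg]; split=> [x|i].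
  by apply: continuousB; [exact: cf|exact: cg].
have [df Cf] := Hf i; have [dg Cg] := Hg i.
split=> [x|]; first exact: derivableB.
suff -> : (fun x => 'D_(delta_mx 0 i) (f - g) x) =
  (fun x => 'D_(delta_mx 0 i) f x) - (fun x => 'D_(delta_mx 0 i) g x) by exact: IH.
by apply/funext => x; rewrite deriveB.
Qed.

Lemma CkD n k (f g : 'rV[R]_n -> R) : Ck k f -> Ck k g -> Ck k (f + g).
Proof.
move=> Cf Cg; rewrite -[g]opprK -[- g]sub0r.
by apply: CkB => //; apply: CkB => //; exact: Ck_cst.
Qed.

Lemma CkM n k (f g : 'rV[R]_n -> R) : Ck k f -> Ck k g -> Ck k (f * g).
Proof.
elim: k f g => [|k IH] f g.
  by move=> /= cf cg x; apply: continuousM; [exact: cf|exact: cg].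
move=> Cf0 Cg0; have := Cg0; have := Cf0; move=> /= [cf Hf] [cg Hg].
split=> [x|i]; first by apply: continuousM; [exact: cf|exact: cg].
have [df Cf] := Hf i; have [dg Cg] := Hg i.
split=> [x|]; first exact: derivableM.
suff -> : (fun x => 'D_(delta_mx 0 i) (f * g) x) =
    f * (fun x => 'D_(delta_mx 0 i) g x) +
    g * (fun x => 'D_(delta_mx 0 i) f x).
  by apply: CkD; apply: IH => //; apply: CkW.
by apply/funext => x; rewrite deriveM.
Qed.

Lemma Ck_comp_colsub m n k (s : 'I_m -> 'I_n) (f : 'rV[R]_m -> R) :
  injective s -> Ck k f -> Ck k (f \o (fun x : 'rV[R]_n => colsub s x)).
Proof.
set L := fun x : 'rV[R]_n => colsub s x => s_inj.
have cL : continuous L.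
  move=> x A [P /= HP sPA].
  exists (fun i j => \bigcap_(k in [set k | s k = j]) P i k) => /= [i j|y Hy].
    have [[l slj]|nl] := pselect (exists l, s l = j).
      suff -> : \bigcap_(k in [set k | s k = j]) P i k = P i l.
        by have := HP i l; rewrite mxE slj.
      apply/seteqP; split=> [u|u Pu k' /= sk'j]; first exact.
      by have -> : k' = l by apply: s_inj; rewrite slj.
    suff -> : \bigcap_(k in [set k | s k = j]) P i k = setT.
      exact: filterT.
    by apply/seteqP; split=> // u _ k' /= sk'j; case: nl; exists k'.
  by apply: sPA => i j /=; rewrite mxE; exact: Hy.
have quot (h : 'rV[R]_m -> R) (a v : 'rV[R]_n) :
    (fun t : R => t^-1 *: (((h \o L) \o shift a) (t *: v) - (h \o L) a)) =
    (fun t => t^-1 *: ((h \o shift (L a)) (t *: L v) - h (L a))).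
  apply/funext => t /=; congr (_ *: (h _ - _)).
  by apply/matrixP => i j; rewrite !mxE.
elim: k f => [|k IH] f.
  by move=> /= cf x; apply: continuous_comp; [exact: cL|exact: cf].
move=> [cf Hf]; split=> [x|j].
  by apply: continuous_comp; [exact: cL|exact: cf].
have [[i sij]|nsj] := pselect (exists i, s i = j).
  have Lj : L (delta_mx 0 j) = delta_mx 0 i.
    by apply/matrixP => a b; rewrite !mxE -sij (inj_eq s_inj).
  have [df Cf] := Hf i.
  split=> [x|]; first by rewrite /derivable quot Lj; exact: df.
  suff -> : (fun x => 'D_(delta_mx 0 j) (f \o L) x) =
    (fun x => 'D_(delta_mx 0 i) f x) \o L by exact: IH.
  by apply/funext => x; rewrite /derive quot Lj.
have Lj : L (delta_mx 0 j) = 0.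
  apply/matrixP => a b; rewrite !mxE andbC; case: eqP => // sb.
  by case: nsj; exists b.
split=> [x|]; first by rewrite /derivable quot Lj; exact: derivable0.
suff -> : (fun x => 'D_(delta_mx 0 j) (f \o L) x) = cst 0 by exact: Ck_cst.
by apply/funext => x; rewrite /derive quot Lj; exact: derive0.
Qed.

End Euclidean.

(** Spaces are sets with a distinguished algebra of real functions, called
    smooth.  Finite-dimensional manifolds, their subsets and products, and the
    inverse limits underlying infinitely prolonged equations are all treated in
    this way, and vector fields are the derivations of that algebra. *)
Record smooth_space (R : realType) := SmoothSpace {
  pts :> Type;
  smth : set (pts -> R);
  smth_cst : forall c : R, smth (cst c);
  smthB : forall f g, smth f -> smth g -> smth (f - g);
  smthM : forall f g, smth f -> smth g -> smth (f * g)
}.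

HB.instance Definition _ (R : realType) (P : smooth_space R) := gen_eqMixin (pts P).
HB.instance Definition _ (R : realType) (P : smooth_space R) := gen_choiceMixin (pts P).

Section SmoothFunctions.
Variables (R : realType) (P : smooth_space R).

Definition smthp : {pred (P -> R)} := fun f => `[< smth f >].

Lemma smthp_subring : subring_closed smthp.
Proof.
split=> [|f g /asboolP sf /asboolP sg|f g /asboolP sf /asboolP sg]; apply/asboolP.
- exact: smth_cst.
- exact: smthB.
- exact: smthM.
Qed.

HB.instance Definition _ := GRing.isSubringClosed.Build (P -> R) smthp smthp_subring.

Record sfun := SFun { sfun_fun :> P -> R; sfunP : sfun_fun \in smthp }.

HB.instance Definition _ := [isSub for sfun_fun].
HB.instance Definition _ := [Choice of sfun by <:].
HB.instance Definition _ :=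
  GRing.SubChoice_isSubComPzRing.Build (P -> R) smthp sfun (subringClosedP _).

Lemma sfun_smth (f : sfun) : smth f.
Proof. by apply/asboolP; exact: sfunP. Qed.

Definition mk_sfun (f : P -> R) (sf : smth f) : sfun := SFun (introT (asboolP _) sf).
Definition scst (c : R) : sfun := mk_sfun (smth_cst P c).

End SmoothFunctions.

(* Every space carries the coarsest topology making its smooth functions
   continuous; on a manifold it is the manifold topology. *)
HB.instance Definition _ (R : realType) (P : smooth_space R) :=
  Topological.copy (pts P)
    (initial_topology (fun p : pts P => (fun f : sfun P => f p) : {ptws sfun P -> R})).

Lemma sfun_continuous (R : realType) (P : smooth_space R) (f : sfun P) : continuous f.
Proof.
pose w := fun p : P => (fun g : sfun P => g p) : {ptws sfun P -> R}.
have wc : continuous w by exact: (@initial_continuous P {ptws sfun P -> R} w).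
move=> p; apply: (@continuous_comp _ _ _ w (fun u => u f)); first exact: wc.
move=> A; rewrite /= => HA.
exact: (@proj_continuous _ (fun=> R : topologicalType) f (w p) A HA).
Qed.

Lemma smooth_continuous (R : realType) (P Q : smooth_space R) (h : P -> Q) :
  (forall f : Q -> R, smth f -> smth (f \o h)) -> continuous h.
Proof.
move=> hs; pose w := fun q : Q => (fun g : sfun Q => g q) : {ptws sfun Q -> R}.
apply: (@continuous_comp_initial Q P {ptws sfun Q -> R} w) => p.
have FF : Filter ((w \o h) @ p) := fmap_filter _ (nbhs_filter p).
apply/(cvg_sup _ _ FF) => f; move: p {FF}; apply: (@continuous_comp_initial {ptws sfun Q -> R} P R
  (fun u => u f)).
exact: (@sfun_continuous R P (mk_sfun (hs f (sfun_smth f)))).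
Qed.

#[local] Obligation Tactic := idtac.

Section VectorFields.
Variables (R : realType) (P : smooth_space R).

Record vfield := VField {
  vact :> sfun P -> sfun P;
  vactD : forall f g, vact (f + g) = vact f + vact g;
  vactZ : forall (c : R) f, vact (scst P c * f) = scst P c * vact f;
  vactM : forall f g, vact (f * g) = vact f * g + f * vact g
}.

HB.instance Definition _ := gen_eqMixin vfield.
HB.instance Definition _ := gen_choiceMixin vfield.

Lemma vfieldP (X Y : vfield) : (forall f, X f = Y f) -> X = Y.
Proof.
case: X Y => [x xD xZ xM] [y yD yZ yM] /= /funext xy.
by subst y; congr VField; exact: Prop_irrelevance.
Qed.

Program Definition vzero := @VField (fun=> 0) _ _ _.
Next Obligation. by move=> f g /=; rewrite addr0. Qed.
Next Obligation. by move=> c f /=; rewrite mulr0. Qed.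
Next Obligation. by move=> f g /=; rewrite mul0r mulr0 addr0. Qed.

Program Definition vadd (X Y : vfield) := @VField (fun f => X f + Y f) _ _ _.
Next Obligation. by move=> X Y f g /=; rewrite !vactD addrACA. Qed.
Next Obligation. by move=> X Y c f /=; rewrite !vactZ mulrDr. Qed.
Next Obligation. by move=> X Y f g /=; rewrite !vactM mulrDl mulrDr addrACA. Qed.

Program Definition vopp (X : vfield) := @VField (fun f => - X f) _ _ _.
Next Obligation. by move=> X f g /=; rewrite vactD opprD. Qed.
Next Obligation. by move=> X c f /=; rewrite vactZ mulrN. Qed.
Next Obligation. by move=> X f g /=; rewrite vactM opprD mulNr mulrN. Qed.

Program Definition vscale (h : sfun P) (X : vfield) := @VField (fun f => h * X f) _ _ _.
Next Obligation. by move=> h X f g /=; rewrite vactD mulrDr. Qed.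
Next Obligation. by move=> h X c f /=; rewrite vactZ mulrCA. Qed.
Next Obligation. by move=> h X f g /=; rewrite vactM mulrDr mulrA [f * (h * X g)]mulrCA. Qed.

Lemma vaddA : associative vadd.
Proof. by move=> X Y Z; apply: vfieldP => f /=; rewrite addrA. Qed.
Lemma vaddC : commutative vadd.
Proof. by move=> X Y; apply: vfieldP => f /=; rewrite addrC. Qed.
Lemma vadd0 : left_id vzero vadd.
Proof. by move=> X; apply: vfieldP => f /=; rewrite add0r. Qed.
Lemma vaddN : left_inverse vzero vopp vadd.
Proof. by move=> X; apply: vfieldP => f /=; rewrite addNr. Qed.

HB.instance Definition _ := GRing.isZmodule.Build vfield vaddA vaddC vadd0 vaddN.

Lemma vscaleA a b X : vscale a (vscale b X) = vscale (a * b) X.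
Proof. by apply: vfieldP => f /=; rewrite mulrA. Qed.
Lemma vscale1 : left_id 1 vscale.
Proof. by move=> X; apply: vfieldP => f /=; rewrite mul1r. Qed.
Lemma vscaleDr : right_distributive vscale +%R.
Proof. by move=> a X Y; apply: vfieldP => f /=; rewrite mulrDr. Qed.
Lemma vscaleDl X : {morph vscale^~ X : a b / a + b}.
Proof. by move=> a b; apply: vfieldP => f /=; rewrite mulrDl. Qed.

HB.instance Definition _ :=
  GRing.Zmodule_isLmodule.Build (sfun P) vfield vscaleA vscale1 vscaleDr vscaleDl.

Program Definition bracket (X Y : vfield) := @VField (fun f => X (Y f) - Y (X f)) _ _ _.
Next Obligation. by move=> X Y f g /=; rewrite !vactD opprD addrACA. Qed.
Next Obligation. by move=> X Y c f /=; rewrite !vactZ mulrBr. Qed.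
Next Obligation.
move=> X Y f g /=; rewrite !vactM !vactD !vactM; ring.
Qed.

End VectorFields.

Section SmoothMaps.
Variable R : realType.
Implicit Types P Q B : smooth_space R.

Record smap P Q := SMap {
  smap_fun :> P -> Q;
  smap_smth : forall f : sfun Q, smth (f \o smap_fun)
}.

Definition pull P Q (p : smap P Q) (f : sfun Q) : sfun P := mk_sfun (smap_smth p f).

(* [related p X Y] is [p_* X = Y] *)
Definition related P Q (p : smap P Q) (X : vfield P) (Y : vfield Q) : Prop :=
  forall f, X (pull p f) = pull p (Y f).

Definition vertical P Q (p : smap P Q) (X : vfield P) : Prop :=
  forall f, X (pull p f) = 0.

Definition connection P B (p : smap P B) (D : vfield B -> vfield P) : Prop :=
  [/\ forall X Y, D (X + Y) = D X + D Y,
      forall (f : sfun B) X, D (f *: X) = pull p f *: D X &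
      forall X, related p (D X) X].

Definition flat P B (D : vfield B -> vfield P) : Prop :=
  forall X Y, D (bracket X Y) = bracket (D X) (D Y).

Definition flat_connection P B (p : smap P B) (D : vfield B -> vfield P) : Prop :=
  connection p D /\ flat D.

(* symmetries of the equation [(p, D)] with independent variables [B] *)
Definition symmetry P B (p : smap P B) (D : vfield B -> vfield P) (S : vfield P) : Prop :=
  vertical p S /\ forall X, bracket S (D X) = 0.

End SmoothMaps.

Section Constructions.
Variable R : realType.

Section Generated.
Variables (T : Type) (G : set (T -> R)).

(* The functions that are, near every point, smooth functions of finitely many
   elements of [G]. *)
Definition gen_smth : set (T -> R) := [set f | forall p,
  exists n (g : 'I_n -> T -> R) (phi : 'rV[R]_n -> R) (e : R),
    [/\ forall i, G (g i), Cinfty phi, 0 < e &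
        forall q, (forall i, `|g i q - g i p| < e) -> f q = phi (\row_i g i q)]].

Lemma gen_smth_cst (c : R) : gen_smth (cst c).
Proof.
move=> p; exists 0, (fun=> cst 0), (cst c), 1; split=> // [[]//|].
by move=> k; exact: Ck_cst.
Qed.

Lemma gen_smth_op (op : R -> R -> R) (f g : T -> R) :
  (forall n k (a b : 'rV[R]_n -> R), Ck k a -> Ck k b -> Ck k (fun x => op (a x) (b x))) ->
  gen_smth f -> gen_smth g -> gen_smth (fun q => op (f q) (g q)).
Proof.
move=> Cop sf sg p.
have [n [a [phi [e [Ga Cphi e0 fE]]]]] := sf p.
have [m [b [psi [d [Gb Cpsi d0 gE]]]]] := sg p.
exists (n + m)%N, (fun i => match fintype.split i with inl j => a j | inr j => b j end).
exists (fun x => op (phi (colsub (@lshift n m) x)) (psi (colsub (@rshift n m) x))).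
exists (Num.min e d); split.
- by move=> i; case: fintype.split => j.
- move=> k; apply: Cop.
    exact: (Ck_comp_colsub (@lshift_inj n m) (Cphi k)).
  exact: (Ck_comp_colsub (@rshift_inj n m) (Cpsi k)).
- by rewrite lt_min e0 d0.
move=> q Hq; rewrite fE ?gE.
- congr (op (phi _) (psi _)); apply/matrixP => i j; rewrite !mxE.
    by case: split_ordP => k /eqP; rewrite ?eq_lshift ?eq_lrshift // => /eqP ->.
  by case: split_ordP => k /eqP; rewrite ?eq_rshift ?eq_rlshift // => /eqP ->.
- move=> i; have := Hq (rshift n i); rewrite lt_min => /andP[_].
  by case: split_ordP => k /eqP; rewrite ?eq_rshift ?eq_rlshift // => /eqP <-.
- move=> i; have := Hq (lshift m i); rewrite lt_min => /andP[+ _].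
  by case: split_ordP => k /eqP; rewrite ?eq_lshift ?eq_lrshift // => /eqP <-.
Qed.

Definition gen : smooth_space R := @SmoothSpace R T gen_smth gen_smth_cst
  (fun f g => @gen_smth_op (fun a b => a - b) f g (fun n k a b => @CkB R n k a b))
  (fun f g => @gen_smth_op (fun a b => a * b) f g (fun n k a b => @CkM R n k a b)).

Lemma gen_smth_sub g : G g -> gen_smth g.
Proof.
move=> Gg p; exists 1, (fun=> g), (fun x => x 0 0), 1; split=> //; last first.
  by move=> q _; rewrite mxE.
case=> [|k] /=; first exact: coord_continuous.
split=> [|i]; first exact: coord_continuous.
have dE : forall x (h : R), h != 0 ->
    h^-1 *: ((h *: delta_mx 0 i + x : 'rV[R]_1) 0 0 - x 0 0) = 1.
  move=> x h h0; rewrite !mxE ord1 !eqxx mulr1 addrK.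
  by rewrite /GRing.scale /= mulVf.
have cvg1 x : (fun h : R => h^-1 *: ((h *: delta_mx 0 i + x : 'rV[R]_1) 0 0 - x 0 0)) @ 0^' --> (1 : R).
  apply: cvg_near_cst; near=> h.
  rewrite dE //; near: h; exact: nbhs_dnbhs_neq.
split=> [x|]; first by apply/cvg_ex; exists 1; exact: cvg1.
suff -> : (fun x : 'rV[R]_1 => 'D_(delta_mx 0 i) (fun y : 'rV[R]_1 => y 0 0) x) = cst 1
  by exact: Ck_cst.
by apply/funext => x; apply: cvg_lim => //; exact: cvg1.
Unshelve. all: by end_near. Qed.

End Generated.

Lemma gen_smth_comp T T' (G : set (T -> R)) (G' : set (T' -> R)) (h : T -> T') f :
  (forall g, G' g -> G (g \o h)) -> gen_smth G' f -> gen_smth G (f \o h).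
Proof.
move=> GG' sf p; have [n [g [phi [e [Gg Cphi e0 fE]]]]] := sf (h p).
exists n, (fun i => g i \o h), phi, e; split=> // [i|q Hq]; first exact: GG'.
by rewrite /= fE.
Qed.

(* the functions on [A] that are locally restrictions of smooth functions *)
Section Subspace.
Variables (P : smooth_space R) (A : set P).

Definition sub_smth : set ({p | A p} -> R) := [set f | forall p : {p : P | A p},
  exists g : sfun P, \forall q \near sval p, forall a : A q, f (exist _ q a) = g q].

Lemma sub_smth_cst (c : R) : sub_smth (cst c).
Proof. move=> p; exists (scst P c); near=> q => a.
Unshelve. all: by end_near. Qed.

Lemma sub_smthB f g : sub_smth f -> sub_smth g -> sub_smth (f - g).
Proof.
move=> sf sg p; have [f' fE] := sf p; have [g' gE] := sg p; exists (f' - g').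
near=> q.
have fq : forall a, f (exist _ q a) = f' q by near: q.
have gq : forall a, g (exist _ q a) = g' q by near: q.
by move=> a; exact: (f_equal2 (fun u v => u - v) (fq a) (gq a)).
Unshelve. all: by end_near. Qed.

Lemma sub_smthM f g : sub_smth f -> sub_smth g -> sub_smth (f * g).
Proof.
move=> sf sg p; have [f' fE] := sf p; have [g' gE] := sg p; exists (f' * g').
near=> q.
have fq : forall a, f (exist _ q a) = f' q by near: q.
have gq : forall a, g (exist _ q a) = g' q by near: q.
by move=> a; exact: (f_equal2 (fun u v => u * v) (fq a) (gq a)).
Unshelve. all: by end_near. Qed.

Definition subsp : smooth_space R := SmoothSpace sub_smth_cst sub_smthB sub_smthM.

Lemma subsp_restr (f : P -> R) : smth f -> smth ((f \o sval) : subsp -> R).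
Proof. by move=> sf p; exists (mk_sfun sf); near=> q => a.
Unshelve. all: by end_near. Qed.

End Subspace.

Lemma subsp_smth_comp (P Q : smooth_space R) (A : set P) (B : set Q) (h : P -> Q)
    (AB : forall p, A p -> B (h p)) (f : subsp B -> R) :
  (forall g : Q -> R, smth g -> smth (g \o h)) -> smth f ->
  smth ((fun p => f (exist _ (h (sval p)) (AB _ (svalP p)))) : subsp A -> R).
Proof.
move=> hs sf p; have [g gE] := sf (exist _ (h (sval p)) (AB _ (svalP p))).
exists (mk_sfun (hs g (sfun_smth g))).
have H := smooth_continuous hs gE.
near=> q; have Hq : forall b, f (exist _ (h q) b) = g (h q) by near: q.
by move=> a; exact: Hq.
Unshelve. all: by end_near. Qed.

Definition prod_gen (P Q : smooth_space R) : set (P * Q -> R) :=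
  [set (f : P -> R) \o fst | f in @smth R P] `|` [set (g : Q -> R) \o snd | g in @smth R Q].

Definition prodsp (P Q : smooth_space R) : smooth_space R := gen (@prod_gen P Q).

Definition fibprod (P Q B : smooth_space R) (p : P -> B) (q : Q -> B) : smooth_space R :=
  @subsp (prodsp P Q) [set u | p u.1 = q u.2].

(* The inverse limit of a tower: smooth functions are those of finite order. *)
Section Limit.
Variables (T : Type) (P : nat -> smooth_space R) (pr : forall l, T -> P l).
Hypothesis prS : forall l (g : P l -> R), smth g ->
  exists2 g' : P l.+1 -> R, smth g' & g \o pr l = g' \o pr l.+1.

Definition lim_smth : set (T -> R) :=
  [set f | exists l, exists2 g : P l -> R, smth g & f = g \o pr l].

Lemma lim_smth_ge l m (g : P l -> R) : (l <= m)%N -> smth g ->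
  exists2 g' : P m -> R, smth g' & g \o pr l = g' \o pr m.
Proof.
move=> /subnKC <-; elim: (m - l)%N => [|d IH] sg.
  by rewrite addn0; exists g.
have [g1 sg1 ->] := IH sg; have [g2 sg2 ->] := prS sg1.
by rewrite addnS; exists g2.
Qed.

Lemma lim_smth_op (op : R -> R -> R) (f g : T -> R) :
  (forall l (a b : P l -> R), smth a -> smth b -> smth (fun x => op (a x) (b x))) ->
  lim_smth f -> lim_smth g -> lim_smth (fun q => op (f q) (g q)).
Proof.
move=> Cop [l [a sa ->]] [m [b sb ->]].
have [a' sa' ->] := lim_smth_ge (leq_maxl l m) sa.
have [b' sb' ->] := lim_smth_ge (leq_maxr l m) sb.
by exists (maxn l m); exists (fun x => op (a' x) (b' x)) => //; exact: Cop.
Qed.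

Lemma lim_smth_cst (c : R) : lim_smth (cst c).
Proof. by exists 0; exists (cst c) => //; exact: smth_cst. Qed.

Definition limsp : smooth_space R := @SmoothSpace R T lim_smth lim_smth_cst
  (fun f g => @lim_smth_op (fun a b => a - b) f g (fun l a b => @smthB R (P l) a b))
  (fun f g => @lim_smth_op (fun a b => a * b) f g (fun l a b => @smthM R (P l) a b)).

End Limit.
End Constructions.

Section Manifolds.
Variable R : realType.
Implicit Types P B F : smooth_space R.

Definition smooth_near P (p : P) (f : P -> R) : Prop :=
  exists g : sfun P, \forall q \near p, f q = g q.

Definition diffeo P F (f : P -> F) : Prop :=
  bijective f /\ forall h : F -> R, smth h <-> smth (h \o f).

(* [psi] below is the inverse of a chart whose image is all of [R^n]. *)
Definition manifold (n : nat) P : Prop :=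
  [/\ hausdorff_space P, @second_countable P,
      forall f : P -> R, (forall p, smooth_near p f) -> smth f &
      forall p : P, exists psi : 'rV[R]_n -> P,
        [/\ injective psi, open (range psi), range psi p &
            forall f : P -> R,
              Cinfty (f \o psi) <-> forall q, range psi q -> smooth_near q f]].

Definition fiber_bundle P B (p : smap P B) : Prop :=
  forall b : B, exists U : set B, [/\ open U, U b &
    exists (F : smooth_space R) (r : nat)
           (f : subsp (p @^-1` U) -> prodsp (subsp U) F),
      [/\ manifold r F, inhabited F, diffeo f & forall q, sval (f q).1 = p (sval q)]].

End Manifolds.

(** Jets of local sections of [nu : N -> M], and infinitely prolonged equations. *)
Section Jets.
Variables (R : realType) (M N : smooth_space R) (nu : smap N M).

Definition local_section (s : M -> N) (x : M) : Prop :=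
  \forall y \near x, nu (s y) = y /\ forall g : sfun N, smooth_near y (g \o s).

Definition iter_der (Xs : seq (vfield M)) (f : sfun M) : sfun M :=
  foldr (fun (X : vfield M) h => X h) f Xs.

(* value at [x] of [X_1 ... X_i h], for [h] smooth near [x] only: vector fields
   act on globally smooth functions, so [h] is replaced by such a function with
   the same germ; the result does not depend on the choice *)
Definition germ_der (Xs : seq (vfield M)) (h : M -> R) (x : M) : R :=
  xget 0 [set r | exists2 f : sfun M, \forall y \near x, h y = f y & r = iter_der Xs f x].

(* A jet of [s] at [x] is encoded by [x] and by all the derivatives at [x] (up to
   the given order) of the functions [g \o s], [g] smooth on [N]; two sections
   have the same encoding exactly when they are tangent to that order. *)
Definition jet_data : Type := M * (sfun N -> seq (vfield M) -> R).

Definition jet_inf (s : M -> N) (x : M) : jet_data :=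
  (x, fun (g : sfun N) Xs => germ_der Xs (g \o s) x).

Definition trunc (k : nat) (t : jet_data) : jet_data :=
  (t.1, fun g Xs => if (size Xs <= k)%N then t.2 g Xs else 0).

Definition jet_of (k : nat) (s : M -> N) (x : M) : jet_data := trunc k (jet_inf s x).

Definition is_jet (k : nat) (t : jet_data) : Prop :=
  exists s x, local_section s x /\ t = jet_of k s x.

Definition is_jet_inf (t : jet_data) : Prop :=
  exists s x, local_section s x /\ t = jet_inf s x.

Definition jet_gen k : set ({t | is_jet k t} -> R) :=
  [set fun t => f (sval t).1 | f in [set: sfun M]] `|`
  [set h | exists (g : sfun N) Xs, h = fun t => (sval t).2 g Xs].

Definition Jet (k : nat) : smooth_space R := gen (@jet_gen k).

Lemma jet_inj k (t u : Jet k) : sval t = sval u -> t = u.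
Proof.
by case: t u => [a pa] [b pb] /= ab; subst b; congr exist; exact: Prop_irrelevance.
Qed.

Lemma truncK k l t : (k <= l)%N -> trunc k (trunc l t) = trunc k t.
Proof.
move=> kl; rewrite /trunc /=; congr pair; apply/funext => g; apply/funext => Xs.
by case: ifP => // /leq_trans -> .
Qed.

Lemma is_jet_trunc k l t : (k <= l)%N -> is_jet l t -> is_jet k (trunc k t).
Proof.
by move=> kl [s [x [sx ->]]]; exists s, x; split=> //; rewrite /jet_of truncK.
Qed.

Lemma is_jet_inf_trunc k t : is_jet_inf t -> is_jet k (trunc k t).
Proof. by move=> [s [x [sx ->]]]; exists s, x. Qed.

Definition jproj k l (kl : (k <= l)%N) (t : Jet l) : Jet k :=
  exist _ (trunc k (sval t)) (is_jet_trunc kl (svalP t)).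

Lemma jproj_comp k l m (kl : (k <= l)%N) (lm : (l <= m)%N) (km : (k <= m)%N) t :
  jproj kl (jproj lm t) = jproj km t.
Proof. by apply: eq_exist; rewrite /= truncK. Qed.

Lemma jproj_smth k l (kl : (k <= l)%N) (f : Jet k -> R) :
  smth f -> smth (f \o jproj kl).
Proof.
apply: gen_smth_comp => h [[g _ <-]|[g [Xs ->]]]; first by left; exists g.
have [sX|sX] := boolP (size Xs <= k)%N.
  by right; exists g, Xs; apply/funext => t /=; rewrite sX.
left; exists 0 => //; apply/funext => t /=; rewrite (negbTE sX) //.
Qed.

(** A differential equation of order [k] is a subset [eqn] of [Jet k] (see
    [formally_integrable] for the regularity conditions). *)
Section Prolongation.
Variables (k : nat) (eqn : set (Jet k)).

(* The jet at [x] of [s] lies in the [l]-th prolongation when the graph of its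
   [k]-jet is tangent to [eqn] to order [l] at that point, i.e. when every
   function [F] vanishing on [eqn] near the point restricts to the graph as a
   function [f] of [y] whose derivatives of order at most [l] vanish at [x]. *)
Definition tangent (l : nat) (s : M -> N) (x : M) (t : Jet k) : Prop :=
  forall F : sfun (Jet k), (\forall u \near t, eqn u -> F u = 0) ->
  exists2 f : sfun M,
    \forall y \near x, forall u : Jet k, sval u = jet_of k s y -> F u = f y &
    forall Xs, (size Xs <= l)%N -> iter_der Xs f x = 0.

Definition prolong (l : nat) : set (Jet (k + l)) := [set t |
  eqn (jproj (leq_addr l k) t) /\
  exists s x, [/\ local_section s x, sval t = jet_of (k + l) s x &
                  tangent l s x (jproj (leq_addr l k) t)]].

Definition Eq (l : nat) : smooth_space R := subsp (@prolong l).

Lemma leq_addS l : (k + l <= k + l.+1)%N.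
Proof. by rewrite leq_add2l leqnSn. Qed.

Lemma prolong_jproj l (t : Jet (k + l.+1)) :
  prolong t -> prolong (jproj (leq_addS l) t).
Proof.
move=> [et [s [x [sx tE tan]]]]; rewrite /prolong /= (jproj_comp _ _ (leq_addr l.+1 k)).
split=> //; exists s, x; split=> //; first by rewrite tE /jet_of truncK ?leq_addS.
move=> F /tan [f fE f0]; exists f => // Xs sXs; apply: f0; exact: leq_trans sXs _.
Qed.

Definition eq_proj l (t : Eq l.+1) : Eq l :=
  exist _ (jproj (leq_addS l) (sval t)) (prolong_jproj (svalP t)).

Lemma eq_proj_smth l (f : Eq l -> R) : smth f -> smth (f \o @eq_proj l).
Proof.
by apply: (subsp_smth_comp (@prolong_jproj l)) => g; exact: jproj_smth.
Qed.

Definition eq_smap l : smap (Eq l.+1) (Eq l) :=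
  SMap (fun f : sfun (Eq l) => eq_proj_smth (sfun_smth f)).

Definition formally_integrable : Prop := forall l,
  (exists d, manifold d (Eq l)) /\ fiber_bundle (eq_smap l).

Definition is_Einf (t : jet_data) : Prop :=
  is_jet_inf t /\ forall l, exists2 u, @prolong l u & sval u = trunc (k + l) t.

Lemma is_Einf_prolong l t (e : is_Einf t) :
  prolong (exist _ (trunc (k + l) t) (is_jet_inf_trunc (k + l) e.1) : Jet (k + l)).
Proof.
have [u pu uE] := e.2 l.
by rewrite (_ : (exist _ _ _ : Jet (k + l)) = u) //; exact: jet_inj.
Qed.

Definition einf_proj l (t : {t | is_Einf t}) : Eq l :=
  exist _ _ (is_Einf_prolong l (svalP t)).

Lemma einf_projS l (t : {t | is_Einf t}) : eq_proj (einf_proj l.+1 t) = einf_proj l t.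
Proof. by do 2 apply: eq_exist; rewrite /= truncK ?leq_addS. Qed.

Lemma einf_step l (g : Eq l -> R) : smth g ->
  exists2 g' : Eq l.+1 -> R, smth g' & g \o einf_proj l = g' \o einf_proj l.+1.
Proof.
move=> sg; exists (g \o @eq_proj l); first exact: eq_proj_smth.
by apply/funext => t /=; rewrite einf_projS.
Qed.

(* the infinite prolongation, and its projection to [M] *)
Definition Einf : smooth_space R := limsp einf_step.

Definition base (t : Einf) : M := (sval t).1.

Lemma base_smth (f : sfun M) : smth (f \o base).
Proof.
exists 0; exists (fun t : Eq 0 => f (sval (sval t)).1) => //.
apply: (@subsp_restr _ _ _ (fun t : Jet (k + 0) => f (sval t).1)).
by apply: gen_smth_sub; left; exists f.
Qed.

Definition xi : smap Einf M := SMap base_smth.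

(* [C X] is the total derivative: if, near a point of [Einf], the function [phi] is
   the restriction of a smooth function [f] on [Jet (k + l)], then the value of
   [C X phi] at that point, the infinite jet of [s] at [x], is the derivative along
   [X] at [x] of the composition [h] of [f] with the [(k + l)]-jet of [s]. *)
Definition Cartan_connection (C : vfield M -> vfield Einf) : Prop :=
  forall (X : vfield M) (phi : sfun Einf) (t : Einf) l (f : sfun (Jet (k + l)))
         (s : M -> N) (x : M) (h : M -> R),
    (\forall u \near (sval (einf_proj l t) : Jet (k + l)),
       forall t' : Einf, sval (einf_proj l t') = u -> phi t' = f u) ->
    local_section s x -> sval t = jet_inf s x ->
    (\forall y \near x, forall u : Jet (k + l), sval u = jet_of (k + l) s y -> h y = f u) ->
    C X phi t = germ_der [:: X] h x.

End Prolongation.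
End Jets.

(** The pullback of a bundle [pi : E -> M] to an infinitely prolonged equation, and
    the complex of the covering. *)
Section Covering.
Variables (R : realType) (M N E : smooth_space R) (nu : smap N M) (k : nat) (eqn : set (Jet nu k)).
Variable pi : smap E M.

Definition base_l l (t : Eq eqn l) : M := (sval (sval t)).1.

Definition Cov_l (l : nat) : smooth_space R := fibprod (@base_l l) pi.

Definition cov_pts : Type := {u : Einf eqn * E | base u.1 = pi u.2}.

Definition cov_proj l (u : cov_pts) : Cov_l l :=
  exist (fun v : prodsp (Eq eqn l) E => base_l v.1 = pi v.2)
    (einf_proj l (sval u).1, (sval u).2) (svalP u).

Lemma cov_step l (g : Cov_l l -> R) : smth g ->
  exists2 g' : Cov_l l.+1 -> R, smth g' & g \o @cov_proj l = g' \o @cov_proj l.+1.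
Proof.
move=> sg; pose h (v : prodsp (Eq eqn l.+1) E) : prodsp (Eq eqn l) E := (eq_proj v.1, v.2).
have hs (f : prodsp (Eq eqn l) E -> R) : smth f -> smth (f \o h).
  apply: gen_smth_comp => _ [[f' sf' <-]|[f' sf' <-]]; last by right; exists f'.
  by left; exists (f' \o @eq_proj _ _ _ _ _ eqn l) => //; exact: eq_proj_smth.
pose A l' := [set v : prodsp (Eq eqn l') E | base_l v.1 = pi v.2].
have AB v : A l.+1 v -> A l (h v) by [].
exists (fun v => g (exist (A l) (h (sval v)) (AB _ (svalP v)))).
  exact: (subsp_smth_comp AB hs sg).
apply/funext => u; rewrite /=; congr (g _).
apply: eq_exist; rewrite /h /=; congr pair; exact/esym/einf_projS.
Qed.

(* [E'], the fibre product of [Einf] and [E] over [M], with its projections *)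
Definition Cov : smooth_space R := limsp cov_step.

Lemma tau_smth (f : sfun (Einf eqn)) : smth (f \o (fun u : Cov => (sval u).1)).
Proof.
have [l [g sg fE]] := sfun_smth f; exists l.
exists (fun v : Cov_l l => g (sval v).1); last first.
  by apply/funext => u /=; rewrite fE.
apply: (@subsp_restr _ _ _ (fun v : prodsp (Eq eqn l) E => g v.1)).
by apply: gen_smth_sub; left; exists g.
Qed.

Lemma xi'_smth (f : sfun E) : smth (f \o (fun u : Cov => (sval u).2)).
Proof.
exists 0; exists (fun v : Cov_l 0 => f (sval v).2) => //.
apply: (@subsp_restr _ _ _ (fun v : prodsp (Eq eqn 0) E => f v.2)).
by apply: gen_smth_sub; right; exists f => //; exact: sfun_smth.
Qed.

Definition tau : smap Cov (Einf eqn) := SMap tau_smth.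
Definition xi' : smap Cov E := SMap xi'_smth.

Lemma covM_smth (f : sfun M) : smth (f \o (fun u : Cov => pi (xi' u))).
Proof. exact: (sfun_smth (pull xi' (pull pi f))). Qed.

Definition covM : smap Cov M := SMap covM_smth.

Variables (C : vfield M -> vfield (Einf eqn)) (F : vfield M -> vfield Cov).

Definition covering_structure : Prop :=
  flat_connection covM F /\ forall X, related tau (F X) (C X).

(* [S'] is the canonical lift of the field [S] on [Einf] *)
Definition canonical_lift (S : vfield (Einf eqn)) (S' : vfield Cov) : Prop :=
  vertical xi' S' /\ related tau S' S.

(* the distribution [tau_*^-1] of the Cartan distribution, which spans the flat
   connection in [xi'] *)
Definition CD1 (Z : vfield Cov) : Prop := forall u : Cov,
  exists X : vfield M, forall phi, Z (pull tau phi) u = C X phi (tau u).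

Definition calV (Z : vfield Cov) : Prop := CD1 Z /\ vertical covM Z.

(* A [vfield Cov]-valued [q]-form pulled back from [M] is given by its values on
   [q] vector fields on [M], since [Lambda^q M (x) D] is the module of alternating
   [C^oo(M)]-multilinear maps into [D]; the connection form [U_F] is [F] itself. *)
Definition vform (q : nat) : Type := ('I_q -> vfield M) -> vfield Cov.

Definition vform_of_vfield (Y : vfield Cov) : vform 0 := fun=> Y.

Definition cochain q (w : vform q) : Prop :=
  [/\ forall Xs, calV (w Xs),
      forall Xs i (f : sfun M) X Y,
        w [eta Xs with i |-> f *: X + Y] =
        pull covM f *: w [eta Xs with i |-> X] + w [eta Xs with i |-> Y] &
      forall Xs i j, i != j -> Xs i = Xs j -> w Xs = 0].

(* The Froelicher-Nijenhuis bracket with [U_F] on forms with values vertical over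
   [M]: in coordinates it maps [omega (x) Y], with [omega] closed on [M], to
   [sum_i (dx_i /\ omega) (x) [F d_i, Y]]; on a vector field [Y] it is
   [X |-> [F X, Y]].  The last sum has the terms
   [w (.., [X_i, X_j], ..)], [i < j], with [X_i] omitted and [X_j] replaced. *)
Definition fn_UF q (w : vform q) : vform q.+1 := fun Xs =>
  \sum_(i < q.+1) (-1) ^+ i *:
    (bracket (F (Xs i)) (w (Xs \o lift i)) -
     \sum_(a < q | (i <= a)%N)
       w [eta Xs \o lift i with a |-> bracket (Xs i) (Xs (lift i a))]).

Definition exact_vform q (c : vform q.+1) : Prop :=
  exists2 w : vform q, cochain w & fn_UF w = c.

End Covering.

(* Main.v *)
Require Import Defs.
From HB Require Import structures.
From mathcomp Require Import all_boot all_order all_algebra.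
From mathcomp Require Import all_classical all_reals topology normedtype derive.

(** Two fields on the covering that are vertical over [M] and project to the same
    field on the equation differ by a [tau]-vertical field.  Hence subtracting a
    primitive [V] of the cocycle from the canonical lift gives a symmetry over [S],
    and conversely the difference of the canonical lift and a symmetry over [S] is
    such a primitive.  What has to be seen is that the elements of [calV] are
    [tau]-vertical: at a point such a field agrees along [tau] with some [C X],
    verticality over [M] forces [X] to vanish at the base point, and total
    derivatives along a vector vanishing at the base point are zero. *)

Set Implicit Arguments.
Unset Strict Implicit.
Unset Printing Implicit Defensive.

Import GRing.Theory.

Local Open Scope classical_set_scope.
Local Open Scope ring_scope.

Section VectorFieldLemmas.
Variable R : realType.
Implicit Types P Q : smooth_space R.

Lemma vact0 P (X : vfield P) : X 0 = 0.
Proof. by apply: (@addrI _ (X 0)); rewrite -vactD !addr0. Qed.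

Lemma vactN P (X : vfield P) f : X (- f) = - X f.
Proof. by apply/eqP; rewrite -addr_eq0 -vactD addNr vact0. Qed.

Lemma bracket_anticomm P (X Y : vfield P) : bracket X Y = - bracket Y X.
Proof. by apply: vfieldP => f /=; rewrite opprB. Qed.

Lemma bracketBr P (X Y Z : vfield P) :
  bracket X (Y - Z) = bracket X Y - bracket X Z.
Proof.
by apply: vfieldP => f /=; rewrite vactD vactN !opprD addrACA.
Qed.

Lemma pull0 P Q (p : smap P Q) : pull p 0 = 0.
Proof. exact/val_inj. Qed.

Lemma pullB P Q (p : smap P Q) (f g : sfun Q) : pull p (f - g) = pull p f - pull p g.
Proof. exact/val_inj. Qed.

Lemma verticalB P Q (p : smap P Q) (X Y : vfield P) :
  vertical p X -> vertical p Y -> vertical p (X - Y).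
Proof. by move=> vX vY f /=; rewrite vX vY subrr. Qed.

Lemma relatedB P Q (p : smap P Q) (X Y : vfield P) (X' Y' : vfield Q) :
  related p X X' -> related p Y Y' -> related p (X - Y) (X' - Y').
Proof. by move=> rX rY f /=; rewrite rX rY -pullB. Qed.

Lemma related_vertical P Q (p : smap P Q) (X : vfield P) :
  related p X 0 <-> vertical p X.
Proof. by split=> H f; rewrite H /= pull0. Qed.

End VectorFieldLemmas.

Section TotalDerivative.
Variables (R : realType) (M N : smooth_space R) (nu : smap N M) (k : nat).
Variables (eqn : set (Jet nu k)) (C : vfield M -> vfield (Einf eqn)).
Hypothesis CC : Cartan_connection C.

(** A value chosen by [xget] is [X f x] for some global [f] with the germ of [h]; if there is no
    such [f], the default is already 0. *)
Lemma germ_der1_eq0 (X : vfield M) (x : M) (h : M -> R) :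
  (forall f, X f x = 0) -> germ_der [:: X] h x = 0.
Proof.
by move=> X0; rewrite /germ_der; case: xgetP => // r _ [f _ ->] /=.
Qed.

Lemma Cartan_eq0 (X : vfield M) (t : Einf eqn) :
  (forall f, X f (xi eqn t) = 0) -> forall phi, C X phi t = 0.
Proof.
move=> X0 phi; have [l [g sg phiE]] := sfun_smth phi.
have [f fE] := sg (einf_proj l t).
have [[s [x [sx tE]]] _] := svalP t.
(* [h] is [f] along the jet of [s], made total by the default 0 where that jet is no point of
   [Jet nu (k + l)]; by [jet_inj] the value does not depend on the choice of [u]. *)
pose h y := xget 0 [set r | exists2 u : Jet nu (k + l),
                              sval u = jet_of (k + l) s y & r = f u].
rewrite (CC (f := f) (s := s) (x := x) (h := h) X _ sx tE).
- by apply: germ_der1_eq0 => f'; have := X0 f'; rewrite /= /base tE.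
- apply: filterS fE => u fu t' t'u; rewrite phiE /=.
  case: (einf_proj l t') t'u => v pv /= vu; subst v; exact: fu.
- near=> y => u uy; rewrite /h; case: xgetP => [r _ [v vy ->]|/(_ (f u)) []].
    by congr (f _); apply: jet_inj; rewrite vy uy.
  by exists u.
Unshelve. all: by end_near.
Qed.

End TotalDerivative.

Section Covering.
Variables (R : realType) (M N E : smooth_space R) (nu : smap N M) (k : nat).
Variables (eqn : set (Jet nu k)) (pi : smap E M).
Variables (C : vfield M -> vfield (Einf eqn)) (F : vfield M -> vfield (Cov eqn pi)).
Implicit Types (Y Z : vfield (Cov eqn pi)) (f : sfun M).

(** This is the equation defining the points of the fibre product. *)
Lemma pull_covM_tau f : pull (covM eqn pi) f = pull (tau eqn pi) (pull (xi eqn) f).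
Proof.
by apply/val_inj/funext => u; rewrite /= -(svalP u).
Qed.

Lemma vertical_covM_xi' Y : vertical (xi' eqn pi) Y -> vertical (covM eqn pi) Y.
Proof.
move=> vY f; have -> : pull (covM eqn pi) f = pull (xi' eqn pi) (pull pi f).
  exact/val_inj.
exact: vY.
Qed.

Lemma vertical_covM_tau Y : vertical (tau eqn pi) Y -> vertical (covM eqn pi) Y.
Proof. by move=> vY f; rewrite pull_covM_tau vY. Qed.

Lemma calVP Z : Cartan_connection C -> covering_structure C F ->
  calV C Z <-> vertical (tau eqn pi) Z.
Proof.
move=> CC [[[FD _ FM] _] FC]; split=> [[CZ vZ] phi|vZ].
  apply/val_inj/funext => u; have [X ZX] := CZ u.
  rewrite [LHS]ZX; apply: (Cartan_eq0 CC) => f.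
  have : C X (pull (xi eqn) f) (tau eqn pi u) = 0.
    by rewrite -ZX -pull_covM_tau vZ.
  (* That [C X] projects to [X] is read off from [F X], which projects to [C X] along [tau] and to
     [X] along [covM]. *)
  have /(congr1 (fun g : sfun _ => g u)) /= <- := FC X (pull (xi eqn) f).
  rewrite -pull_covM_tau FM /=.
  by rewrite -(svalP u).
split; last exact: vertical_covM_tau.
(* The zero field serves at every point: [F 0] vanishes by additivity, hence so does its projection
   [C 0]. *)
move=> u; exists 0 => phi; rewrite vZ.
have F0 : F 0 = 0 by apply: (@addrI _ (F 0)); rewrite -FD !addr0.
by have /(congr1 (fun g : sfun _ => g u)) := FC 0 phi; rewrite F0.
Qed.

Lemma fn_UF0E (w : vform eqn pi 0) Xs :
  fn_UF F w Xs = bracket (F (Xs ord0)) (w (Xs \o lift ord0)).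
Proof.
by rewrite /fn_UF big_ord1 expr0 scale1r big_ord0 subr0.
Qed.

(** In degree 0 the differential is [X |-> [F X, Y]], additive in [Y], so equal coboundaries mean
    that the difference commutes with the connection. *)
Lemma fn_UF_vfieldP Y Z :
  fn_UF F (vform_of_vfield Y) = fn_UF F (vform_of_vfield Z) <->
  forall X, bracket (Y - Z) (F X) = 0.
Proof.
split=> [YZ X|YZ].
  have := congr1 (fun w : vform eqn pi 1 => w (fun=> X)) YZ.
  rewrite /= !fn_UF0E /vform_of_vfield => FYZ.
  by rewrite bracket_anticomm bracketBr FYZ subrr oppr0.
apply/funext => Xs; rewrite !fn_UF0E; apply/eqP; rewrite -subr_eq0 -bracketBr.
by rewrite bracket_anticomm YZ oppr0.
Qed.

(** There is only one family of fields indexed by the empty type ['I_0]. *)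
Lemma vform0E (w : vform eqn pi 0) : exists Y, w = vform_of_vfield Y.
Proof.
exists (w (fun=> 0)); apply/funext => Xs; congr w; apply/funext; by case.
Qed.

Lemma exact_vform1P (c : vform eqn pi 1) :
  exact_vform C F c <-> exists2 V, calV C V & fn_UF F (vform_of_vfield V) = c.
Proof.
split=> [[w [wV _ _] <-]|[V VV <-]].
  by have [V wE] := vform0E w; exists V; rewrite -?wE //; have := wV (fun=> 0); rewrite wE.
(* Linearity and alternation quantify over indices in ['I_0], so they hold vacuously. *)
exists (vform_of_vfield V) => //; split=> // Xs; by case.
Qed.

End Covering.

Theorem theorem6 (R : realType) (M N E : smooth_space R) (m n e k : nat)
    (nu : smap N M) (eqn : set (Jet nu k)) (pi : smap E M)
    (C : vfield M -> vfield (Einf eqn)) (F : vfield M -> vfield (Cov eqn pi))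
    (S : vfield (Einf eqn)) (Shat : vfield (Cov eqn pi)) :
  manifold m M -> manifold n N -> manifold e E ->
  fiber_bundle nu -> formally_integrable eqn -> Cartan_connection C ->
  fiber_bundle pi -> covering_structure C F ->
  symmetry (xi eqn) C S -> canonical_lift S Shat ->
  (exact_vform C F (fn_UF F (vform_of_vfield Shat)) <->
   exists S' : vfield (Cov eqn pi),
     symmetry (covM eqn pi) F S' /\ related (tau eqn pi) S' S).
Proof.
move=> _ _ _ _ _ CC _ cov _ [vS rS].
rewrite exact_vform1P; split=> [[V /(calVP _ CC cov) vV cE]|[S' [[_ sS'] rS']]].
  exists (Shat - V); split; last first.
    rewrite -[S]subr0; apply: relatedB => //; exact/related_vertical.
  split; last by apply/fn_UF_vfieldP.
  by apply: verticalB; [exact: vertical_covM_xi'|exact: vertical_covM_tau].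
exists (Shat - S').
  apply/(calVP _ CC cov)/related_vertical.
  by rewrite -(subrr S); exact: relatedB.
(* [Shat] and the primitive [Shat - S'] differ by [S'], which commutes with every [F X]. *)
by apply/esym/fn_UF_vfieldP; rewrite subKr.
Qed.
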